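(* Consider the $\mathbb{Z}_2$ case, with $\delta=\sqrt2$ and with the 2-box space spanned by the identity $1$ and the element $E$. Let $T_c=\frac{2}{\ln(\sqrt2+1)}$, and for $\beta>0$ (with $\beta=T^{-1}$) let $$B(T,J)=(e^{\beta}-e^{-\beta})\,1+\sqrt2\,e^{-\beta}\,E .$$ Then $$\lim_{n\to\infty}B_{1/2}^n(B(T,J))=\begin{cases}c_1(\beta)\,E, & 0<\beta<T_c^{-1},\\ 0,&\beta=T_c^{-1},\\ c_2(\beta)\,1,&\beta>T_c^{-1},\end{cases}$$ where $c_1(\beta)$ and $c_2(\beta)$ are scalars depending on $\beta$, and both $c_1(\beta)$ and $c_2(\beta)$ are positive.
   Context: In the $\mathbb{Z}_2$ case $\mathscr{P}$ is the planar algebra of the $\mathbb{Z}_2$ subfactor (principal graph $A_3$), with loop value $\delta=\sqrt2$. Its 2-box space is the two-dimensional commutative $C^*$-algebra with basis $1$ (the diagram of two vertical strings) and $E$ (the cup-cap diagram, $E=\delta e_1$ with $e_1$ the Jones projection), $E^2=\delta E$, $E^*=E$. The unnormalized trace is $tr_2(1)=\delta^2=2$, $tr_2(E)=\delta$. The coproduct $*$ is bilinear with $1*1=\delta\,1$ and $E*x=x*E=x$ for all $x$. The contragredient $x\mapsto\overline{x}$ ($180^\circ$ rotation) is linear and fixes $1$ and $E$. Norms: $\|x\|_p=tr_2(|x|^p)^{1/p}$ for $1\le p<\infty$, and $\|x\|_\infty$ is the operator norm. Block maps: for nonzero $x$, $$B_{cm}(x)=\frac{\delta^2}{\|x\|_1\|x\|_2^2}(\overline{x^*}*x)(\overline{x}*x^*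 ),\qquad B_{mc}(x)=\frac{\delta}{\|x\|_\infty\|x\|_2^2}(\overline{x}\,\overline{x^*})*(x^*x),$$ and $B_{1/2}=\frac12B_{cm}+\frac12B_{mc}$. $B_{1/2}^n$ is the $n$-fold iterate. *)

(* Defs.v *)
From Stdlib Require Import Reals Lra.
From Coquelicot Require Import Coquelicot.
Open Scope R_scope.

Definition delta : R := sqrt 2.

(* The pair (a, b) stands for a 1 + b E, so [Id2] is (1, 0) and the linear
   structure and topology are those of C^2.  The algebra product [mul] is not
   the componentwise one. *)
Definition P2 : Type := prod_NormedModule C_AbsRing C_NormedModule C_NormedModule.

Definition padd (x y : P2) : P2 := (Cplus (fst x) (fst y), Cplus (snd x) (snd y)).
Definition pscal (c : C) (x : P2) : P2 := (Cmult c (fst x), Cmult c (snd x)).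
Definition pzero : P2 := (RtoC 0, RtoC 0).
Definition Id2 : P2 := (RtoC 1, RtoC 0).
Definition E : P2 := (RtoC 0, RtoC 1).

(* Bilinear extension of 1 1 = 1, 1 E = E 1 = E, E E = delta E. *)
Definition mul (x y : P2) : P2 :=
  let (a, b) := x in let (c, d) := y in
  (Cmult a c, Cplus (Cplus (Cmult a d) (Cmult b c)) (Cmult delta (Cmult b d))).

(* Bilinear extension of 1 * 1 = delta 1, E * x = x * E = x. *)
Definition coprod (x y : P2) : P2 :=
  let (a, b) := x in let (c, d) := y in
  (Cplus (Cmult delta (Cmult a c)) (Cplus (Cmult a d) (Cmult b c)), Cmult b d).

(* Conjugate-linear with 1 and E self-adjoint. *)
Definition adj (x : P2) : P2 := (Cconj (fst x), Cconj (snd x)).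

(* The rotation is linear and fixes the basis, hence every element. *)
Definition contra (x : P2) : P2 := padd (pscal (fst x) Id2) (pscal (snd x) E).

Definition tr2 (x : P2) : C :=
  Cplus (Cmult (fst x) (RtoC (delta ^ 2))) (Cmult (snd x) delta).

(* Functional calculus: a 1 + b E has eigenvalue a + delta b on the Jones
   projection e1 = E / delta and eigenvalue a on 1 - e1. *)
Definition e1 : P2 := pscal (RtoC (/ delta)) E.
Definition e1c : P2 := padd Id2 (pscal (RtoC (-1)) e1).
Definition eig1 (x : P2) : C := Cplus (fst x) (Cmult delta (snd x)).
Definition eig1c (x : P2) : C := fst x.
Definition fcalc (f : C -> C) (x : P2) : P2 :=
  padd (pscal (f (eig1 x)) e1) (pscal (f (eig1c x)) e1c).

(* Real powers of nonnegative numbers, for exponents p > 0; [Rpower 0 p] is not 0. *)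
Definition rpow (r p : R) : R := if Rle_dec r 0 then 0 else Rpower r p.

(* |x| = (x^* x)^(1/2); the spectrum of x^* x is real and nonnegative. *)
Definition pabs (x : P2) : P2 := fcalc (fun z => RtoC (sqrt (Re z))) (mul (adj x) x).
Definition ppow (p : R) (x : P2) : P2 := fcalc (fun z => RtoC (rpow (Re z) p)) x.

(* The trace of the positive element |x|^p is real. *)
Definition nrm (p : R) (x : P2) : R := rpow (Re (tr2 (ppow p (pabs x)))) (/ p).

(* Operator norm of x acting by multiplication on L^2(P2, tr2). *)
Definition nrm_oo (x : P2) : R :=
  real (Lub_Rbar (fun r => exists y : P2, nrm 2 y <= 1 /\ r = nrm 2 (mul x y))).

Definition Bcm (x : P2) : P2 :=
  pscal (RtoC (delta ^ 2 / (nrm 1 x * nrm 2 x ^ 2)))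
    (mul (coprod (contra (adj x)) x) (coprod (contra x) (adj x))).

Definition Bmc (x : P2) : P2 :=
  pscal (RtoC (delta / (nrm_oo x * nrm 2 x ^ 2)))
    (coprod (mul (contra x) (contra (adj x))) (mul (adj x) x)).

Definition Bhalf (x : P2) : P2 :=
  padd (pscal (RtoC (1 / 2)) (Bcm x)) (pscal (RtoC (1 / 2)) (Bmc x)).

Definition Tc : R := 2 / ln (sqrt 2 + 1).

Definition Boltz (beta : R) : P2 :=
  padd (pscal (RtoC (exp beta - exp (- beta))) Id2)
       (pscal (RtoC (sqrt 2 * exp (- beta))) E).

Definition converges_to (u : nat -> P2) (l : P2) : Prop :=
  filterlim u eventually
    (@locally (prod_NormedModule C_AbsRing C_NormedModule C_NormedModule) l).

Ltac p2_eq :=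
  apply injective_projections; apply injective_projections; simpl; try ring.

Lemma delta_sq : delta * delta = 2.
Proof. unfold delta. apply sqrt_sqrt. lra. Qed.

Lemma delta_pos : 0 < delta.
Proof. unfold delta. apply sqrt_lt_R0. lra. Qed.

Lemma mul_E_E : mul E E = pscal delta E.
Proof. p2_eq. Qed.

Lemma coprod_Id2_Id2 : coprod Id2 Id2 = pscal delta Id2.
Proof. p2_eq. Qed.

Lemma coprod_E_l (x : P2) : coprod E x = x.
Proof. destruct x as [[a b] [c d]]; p2_eq. Qed.

Lemma coprod_E_r (x : P2) : coprod x E = x.
Proof. destruct x as [[a b] [c d]]; p2_eq. Qed.

Lemma contra_id (x : P2) : contra x = x.
Proof. destruct x as [[a b] [c d]]; p2_eq. Qed.

Lemma tr2_Id2 : tr2 Id2 = RtoC (delta ^ 2).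
Proof. apply injective_projections; simpl; ring. Qed.

Lemma tr2_E : tr2 E = RtoC delta.
Proof. apply injective_projections; simpl; ring. Qed.

Lemma fcalc_id (x : P2) : fcalc (fun z => z) x = x.
Proof.
pose proof delta_pos.
destruct x as [[a b] [c d]]; p2_eq; field; lra.
Qed.

Lemma fcalc_mul (f g : C -> C) (x : P2) :
  mul (fcalc f x) (fcalc g x) = fcalc (fun z => Cmult (f z) (g z)) x.
Proof.
pose proof delta_pos.
unfold fcalc; generalize (f (eig1 x)) (f (eig1c x)) (g (eig1 x)) (g (eig1c x)).
intros [? ?] [? ?] [? ?] [? ?]; p2_eq; field; lra.
Qed.

Lemma pabs_sq (x : P2) : mul (pabs x) (pabs x) = mul (adj x) x.
Proof.
assert (P : forall z : C, 0 <= Re z -> Im z = 0 ->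
  Cmult (RtoC (sqrt (Re z))) (RtoC (sqrt (Re z))) = z).
{ intros [u v] Hu Hv; simpl in *; subst v.
  apply injective_projections; simpl; [|ring].
  rewrite Rmult_0_l, Rminus_0_r; now apply sqrt_sqrt. }
rewrite <- (fcalc_id (mul (adj x) x)).
unfold pabs; rewrite fcalc_mul; unfold fcalc at 1.
rewrite !P; [reflexivity| | | |];
  destruct x as [[a b] [c d]]; simpl; try ring.
- replace (_ - _) with (a ^ 2 + b ^ 2) by ring.
  apply Rplus_le_le_0_compat; apply pow2_ge_0.
- match goal with |- 0 <= ?t => replace t with
    ((a + delta * c) ^ 2 + (b + delta * d) ^ 2) by ring end.
  apply Rplus_le_le_0_compat; apply pow2_ge_0.
Qed.

(* Main.v *)
Require Import Defs.
From Stdlib Require Import Reals Lra.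
From Coquelicot Require Import Coquelicot.
Open Scope R_scope.

(** The two spectral projections of the algebra both have trace 1, so the norms
    of [a 1 + b E] are the usual [l^p] norms of its eigenvalues [a + delta b]
    and [a].  For positive [a], [b] this makes the block map explicit: with
    [N = a^2 + delta a b + b^2], [u = a + delta b], [v = delta a + b],

      [Bcm (a, b) = (2 a^2 u^2, delta b^2 v^2) / (delta v N)],
      [Bmc (a, b) = (delta a^2 u^2, 2 b^2 v^2) / (delta u N)].

    Exchanging [1] and [E] swaps [Bcm] and [Bmc], so their average commutes with
    this exchange and is described by a single function [half_coef] of two
    variables ([Bhalf_real]).  The diagonal [a = b] is therefore invariant, and
    by symmetry it is enough to follow orbits in the cone [0 < b <= a].

    In this cone three monotone quantities settle the dynamics:
    [b] shrinks by a factor of at most 8/9 ([minor_contracts]), the combination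
    [a + 5 b] does not increase ([combined_decreases]) and the gap [a - b] does
    not decrease ([gap_increases]).  Hence [b] tends to 0, and the gap is
    monotone and bounded, so [a] converges to a limit that is at least the
    initial gap.  Off the diagonal that limit is positive, while on the diagonal
    both coordinates tend to 0.

    Finally the gap of [Boltz beta] has the sign of
    [exp (2 beta) - (sqrt 2 + 1)] ([Boltz_gap]), and [/ Tc] is exactly the
    inverse temperature at which it vanishes: the critical point is the
    self-dual one. *)

(** * Spectral form of the trace and the norms *)

Lemma eig1_fcalc (f : C -> C) (x : P2) : eig1 (fcalc f x) = f (eig1 x).
Proof.
pose proof delta_pos.
unfold fcalc; generalize (f (eig1 x)) (f (eig1c x)); intros [? ?] [? ?].
apply injective_projections; simpl; field; lra.
Qed.

Lemma eig1c_fcalc (f : C -> C) (x : P2) : eig1c (fcalc f x) = f (eig1c x).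
Proof.
unfold fcalc; generalize (f (eig1 x)) (f (eig1c x)); intros [? ?] [? ?].
apply injective_projections; simpl; ring.
Qed.

Lemma eig1_mul (x y : P2) : eig1 (mul x y) = Cmult (eig1 x) (eig1 y).
Proof.
destruct x as [[? ?] [? ?]], y as [[? ?] [? ?]].
apply injective_projections; simpl; ring.
Qed.

Lemma eig1c_mul (x y : P2) : eig1c (mul x y) = Cmult (eig1c x) (eig1c y).
Proof. now destruct x, y. Qed.

Lemma eig1_adj (x : P2) : eig1 (adj x) = Cconj (eig1 x).
Proof.
destruct x as [[? ?] [? ?]].
apply injective_projections; simpl; ring.
Qed.

Lemma tr2_eig (x : P2) : tr2 x = Cplus (eig1 x) (eig1c x).
Proof.
pose proof delta_sq as D.
destruct x as [[? ?] [? ?]].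
apply injective_projections; simpl; ring [D].
Qed.

Lemma Re_conj_mul (z : C) : Re (Cmult (Cconj z) z) = Cmod z ^ 2.
Proof.
destruct z as [u v]; unfold Cmod; rewrite pow2_sqrt; simpl; [ring | nra].
Qed.

Lemma nrm_eig (p : R) (x : P2) :
  nrm p x = rpow (rpow (Cmod (eig1 x)) p + rpow (Cmod (eig1c x)) p) (/ p).
Proof.
unfold nrm, ppow; rewrite tr2_eig, eig1_fcalc, eig1c_fcalc.
unfold pabs; rewrite eig1_fcalc, eig1c_fcalc, eig1_mul, eig1c_mul, eig1_adj.
change (eig1c (adj x)) with (Cconj (eig1c x)).
rewrite !Re_conj_mul; cbn [Re RtoC fst Cplus].
now rewrite !sqrt_pow2 by apply Cmod_ge_0.
Qed.

Lemma rpow_1 (r : R) : 0 <= r -> rpow r 1 = r.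
Proof.
intros Hr; unfold rpow; destruct (Rle_dec r 0); [lra|].
apply Rpower_1; lra.
Qed.

Lemma rpow_2 (r : R) : 0 <= r -> rpow r 2 = r ^ 2.
Proof.
intros Hr; unfold rpow; destruct (Rle_dec r 0).
- replace r with 0 by lra; ring.
- change 2 with (INR 2); apply Rpower_pow; lra.
Qed.

Lemma rpow_half (r : R) : rpow r (/ 2) = sqrt r.
Proof.
unfold rpow; destruct (Rle_dec r 0).
- symmetry; now apply sqrt_neg_0.
- apply Rpower_sqrt; lra.
Qed.

Lemma nrm_1 (x : P2) : nrm 1 x = Cmod (eig1 x) + Cmod (eig1c x).
Proof.
pose proof (Cmod_ge_0 (eig1 x)); pose proof (Cmod_ge_0 (eig1c x)).
rewrite nrm_eig, Rinv_1, (rpow_1 (Cmod (eig1 x))), (rpow_1 (Cmod (eig1c x)));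
  [apply rpow_1 | |]; lra.
Qed.

Lemma nrm_2 (x : P2) : nrm 2 x = sqrt (Cmod (eig1 x) ^ 2 + Cmod (eig1c x) ^ 2).
Proof.
rewrite nrm_eig, rpow_half, !rpow_2; auto using Cmod_ge_0.
Qed.

(** For positive coefficients [eig1] is the dominant eigenvalue, and the
    supremum is attained at its spectral projection [e1]. *)
Lemma nrm_oo_eig (x : P2) :
  Cmod (eig1c x) <= Cmod (eig1 x) -> nrm_oo x = Cmod (eig1 x).
Proof.
intros Hx; unfold nrm_oo.
pose proof (Cmod_ge_0 (eig1 x)) as P1; pose proof (Cmod_ge_0 (eig1c x)) as Pc.
rewrite (is_lub_Rbar_unique _ (Finite (Cmod (eig1 x)))); [reflexivity|].
split.
- intros r [y [Hy ->]]; cbn.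
  rewrite nrm_2 in Hy |- *; rewrite eig1_mul, eig1c_mul, !Cmod_mult.
  set (s := Cmod (eig1 y) ^ 2 + Cmod (eig1c y) ^ 2) in *.
  assert (Hs : 0 <= s) by (unfold s; nra).
  apply Rle_trans with (Cmod (eig1 x) * sqrt s).
  + rewrite <- (sqrt_pow2 (Cmod (eig1 x))) at 2 by assumption.
    rewrite <- sqrt_mult by nra.
    apply sqrt_le_1_alt; unfold s.
    assert (Cmod (eig1c x) ^ 2 <= Cmod (eig1 x) ^ 2) by nra.
    pose proof (pow2_ge_0 (Cmod (eig1c y))); nra.
  + nra.
- intros b Hb; apply Hb; exists e1.
  assert (A : eig1 e1 = RtoC 1).
  { pose proof delta_pos.
    apply injective_projections; simpl; field; lra. }
  assert (B : eig1c e1 = RtoC 0).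
  { apply injective_projections; simpl; ring. }
  rewrite !nrm_2, eig1_mul, eig1c_mul, A, B, !Cmod_mult, Cmod_1, Cmod_0.
  split.
  + replace (1 ^ 2 + 0 ^ 2) with 1 by ring; rewrite sqrt_1; lra.
  + replace ((_ * 1) ^ 2 + _) with (Cmod (eig1 x) ^ 2) by ring.
    now rewrite sqrt_pow2.
Qed.

(** * The block map on positive elements *)

Definition real_elt (p : R * R) : P2 := (RtoC (fst p), RtoC (snd p)).

(** The coefficient of [1] in the image of [a 1 + b E]; the coefficient of [E]
    is the same expression with [a] and [b] exchanged. *)
Definition half_coef (a b : R) : R :=
  a ^ 2 * (a + delta * b) * (2 * delta * a + 3 * b) /
  (2 * (a ^ 2 + delta * a * b + b ^ 2) * (delta * a + b)).

Definition half_step (p : R * R) : R * R :=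
  (half_coef (fst p) (snd p), half_coef (snd p) (fst p)).

(** Substituting the norms leaves a rational identity modulo [delta^2 = 2].  The
    simple form of the result is due to the quartic coefficients of [Bcm] and
    [Bmc] all being constant multiples of the squares [(a (a + delta b))^2] and
    [(b (delta a + b))^2]. *)
Lemma Bhalf_real (a b : R) : 0 < a -> 0 < b ->
  Bhalf (real_elt (a, b)) = real_elt (half_step (a, b)).
Proof.
intros Ha Hb.
pose proof delta_pos as D0; pose proof delta_sq as D.
assert (0 < delta * a) by nra; assert (0 < delta * b) by nra.
assert (0 < delta * a * b) by nra.
assert (L1 : Cmod (eig1 (real_elt (a, b))) = a + delta * b).
{ replace (eig1 _) with (RtoC (a + delta * b)).
  - rewrite Cmod_R; apply Rabs_pos_eq; lra.
  - apply injective_projections; simpl; ring. }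
assert (L2 : Cmod (eig1c (real_elt (a, b))) = a).
{ simpl; rewrite Cmod_R; apply Rabs_pos_eq; lra. }
assert (N1 : nrm 1 (real_elt (a, b)) = delta * (delta * a + b)).
{ rewrite nrm_1, L1, L2; ring [D]. }
assert (N2 : nrm 2 (real_elt (a, b)) ^ 2 = 2 * (a ^ 2 + delta * a * b + b ^ 2)).
{ rewrite nrm_2, L1, L2, pow2_sqrt by nra; ring [D]. }
assert (Noo : nrm_oo (real_elt (a, b)) = a + delta * b).
{ rewrite nrm_oo_eig; rewrite L1; [reflexivity | rewrite L2; lra]. }
unfold Bhalf, Bcm, Bmc; rewrite N1, N2, Noo, !contra_id.
assert (0 < a ^ 2 + delta * a * b + b ^ 2) by nra.
assert (0 < delta * a + b) by nra.
assert (0 < a + delta * b) by nra.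
unfold half_step, half_coef, real_elt; p2_eq; field [D]; repeat split; lra.
Qed.

(** * Monotone quantities of one step *)

Lemma half_coef_pos (a b : R) : 0 < a -> 0 < b -> 0 < half_coef a b.
Proof.
intros Ha Hb; pose proof delta_pos as D0.
assert (0 < delta * a) by nra; assert (0 < delta * b) by nra.
assert (0 < delta * a * b) by nra.
assert (0 < a ^ 2) by nra; assert (0 < b ^ 2) by nra.
unfold half_coef; apply Rdiv_lt_0_compat; repeat apply Rmult_lt_0_compat; lra.
Qed.

(** Both monotonicity estimates for [a] and [b] come from the sign of this
    quadratic form: it is negative for the smaller coefficient and, when the
    ratio is small, positive for the larger one. *)
Lemma half_coef_increment (a b : R) : 0 < a -> 0 < b ->
  half_coef a b - a =
  a * b * (a ^ 2 - delta * a * b - 2 * b ^ 2) /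
  (2 * (a ^ 2 + delta * a * b + b ^ 2) * (delta * a + b)).
Proof.
intros Ha Hb; pose proof delta_pos as D0; pose proof delta_sq as D.
assert (0 < delta * a) by nra; assert (0 < delta * a * b) by nra.
unfold half_coef; field [D]; split; nra.
Qed.

Lemma delta_bounds : 1 < delta < 2.
Proof. pose proof delta_pos; pose proof delta_sq; split; nra. Qed.

(** The constant 8/9 is not sharp; the extreme ratio is reached on the diagonal
    [a = b], where it is [(1 + delta) / (2 delta)], about 0.854. *)
Lemma minor_contracts (a b : R) : 0 < b <= a -> half_coef b a <= 8 / 9 * b.
Proof.
intros [Hb Hab]; pose proof delta_bounds as D0; pose proof delta_sq as D.
assert (I := half_coef_increment b a Hb ltac:(lra)).
set (M := 2 * (b ^ 2 + delta * b * a + a ^ 2) * (delta * b + a)) in I.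
assert (HM : 0 < M).
{ assert (0 < delta * b) by nra; assert (0 < delta * b * a) by nra.
  unfold M; nra. }
enough (b * a * (b ^ 2 - delta * b * a - 2 * a ^ 2) / M <= - (b / 9)) by lra.
apply Rle_div_l; [exact HM|].
(* Expanding in [b] and [a - b] makes every coefficient nonnegative. *)
assert (E0 : b * a * (b ^ 2 - delta * b * a - 2 * a ^ 2) + b / 9 * M =
  - (b / 9) * ((1 + 3 * delta) * b ^ 3 + (33 + 10 * delta) * b ^ 2 * (a - b)
      + (48 + 5 * delta) * b * (a - b) ^ 2 + 16 * (a - b) ^ 3)).
{ unfold M; field [D]. }
assert (0 <= a - b) as Hd by lra; revert E0 Hd; generalize (a - b); intros d E0 Hd.
assert (0 <= (1 + 3 * delta) * b ^ 3 + (33 + 10 * delta) * b ^ 2 * d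
      + (48 + 5 * delta) * b * d ^ 2 + 16 * d ^ 3).
{ repeat apply Rplus_le_le_0_compat; repeat apply Rmult_le_pos;
    try apply pow_le; lra. }
nra.
Qed.

(** The larger coefficient may overshoot, but by no more than a multiple of the
    smaller one, which is summable along an orbit. *)
Lemma major_growth (a b : R) : 0 < b <= a -> half_coef a b - a <= b / 2.
Proof.
intros [Hb Hab]; pose proof delta_bounds as D0; pose proof delta_sq as D.
rewrite half_coef_increment by lra.
assert (0 < delta * a * b) by (repeat apply Rmult_lt_0_compat; lra).
assert (0 < a ^ 2) by nra.
apply Rle_div_l; [apply Rmult_lt_0_compat; nra|].
enough (a * (a ^ 2 - delta * a * b - 2 * b ^ 2) <=
  (a ^ 2 + delta * a * b + b ^ 2) * (delta * a + b)) by nra.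
apply Rle_trans with (a ^ 2 * a).
- assert (0 < delta * a * b + 2 * b ^ 2) by nra; nra.
- apply Rmult_le_compat; nra.
Qed.

(** The weight 5 is chosen so that the loss [5 b / 9] of the smaller coefficient
    covers the possible growth [b / 2] of the larger one. *)
Lemma combined_decreases (a b : R) : 0 < b <= a ->
  half_coef a b + 5 * half_coef b a <= a + 5 * b.
Proof.
intros H; generalize (minor_contracts a b H) (major_growth a b H); lra.
Qed.

(** The denominators [v] and [u] of the two increments combine to a numerator
    antisymmetric in [a] and [b], so it has the factor [a - b], and the cofactor
    is positive.  This gives both the invariance of the cone and the lower bound
    for the limit. *)
Lemma gap_increases (a b : R) : 0 < b <= a ->
  a - b <= half_coef a b - half_coef b a.
Proof.
intros [Hb Hab]; pose proof delta_bounds as D0; pose proof delta_sq as D.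
assert (P0 : 0 < delta * a * b) by (repeat apply Rmult_lt_0_compat; lra).
assert (P1 : 0 < a ^ 2 + delta * a * b + b ^ 2) by nra.
assert (P2 : 0 < delta * a + b) by nra.
assert (P3 : 0 < delta * b + a) by nra.
assert (E0 : half_coef a b - half_coef b a - (a - b) =
  a * b * ((1 + 2 * delta) * (a ^ 3 - b ^ 3) + 4 * a * b * (a - b)) /
  (2 * (a ^ 2 + delta * a * b + b ^ 2) * (delta * a + b) * (delta * b + a))).
{ transitivity ((half_coef a b - a) - (half_coef b a - b)); [ring|].
  rewrite !half_coef_increment by lra; field [D]; nra. }
enough (0 <= half_coef a b - half_coef b a - (a - b)) by lra.
rewrite E0; apply Rdiv_le_0_compat.
- assert (b ^ 3 <= a ^ 3) by (apply pow_incr; lra).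
  repeat apply Rmult_le_pos; try lra.
  apply Rplus_le_le_0_compat; repeat apply Rmult_le_pos; lra.
- repeat apply Rmult_lt_0_compat; lra.
Qed.

(** * Convergence of orbits *)

Definition orbit (p : R * R) (n : nat) : R * R := Nat.iter n half_step p.

Lemma half_step_cone (p : R * R) :
  0 < snd p <= fst p -> 0 < snd (half_step p) <= fst (half_step p).
Proof.
destruct p as [a b]; cbn; intros H; split.
- apply half_coef_pos; lra.
- generalize (gap_increases a b H); lra.
Qed.

Lemma orbit_cone (p : R * R) (n : nat) :
  0 < snd p <= fst p -> 0 < snd (orbit p n) <= fst (orbit p n).
Proof. intros H; induction n; [exact H | now apply half_step_cone]. Qed.

Lemma orbit_minor_vanishes (p : R * R) :
  0 < snd p <= fst p -> is_lim_seq (fun n => snd (orbit p n)) 0.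
Proof.
intros H.
apply is_lim_seq_le_le with (fun _ => 0) (fun n => snd p * (8 / 9) ^ n).
- intros n; split; [apply Rlt_le, (orbit_cone p n H)|].
  induction n as [|n IH]; [simpl; lra|].
  change (snd (orbit p (S n))) with (half_coef (snd (orbit p n)) (fst (orbit p n))).
  generalize (minor_contracts _ _ (orbit_cone p n H)); rewrite <- tech_pow_Rmult; lra.
- apply is_lim_seq_const.
- replace (Finite 0) with (Rbar_mult (snd p) 0) by (simpl; f_equal; ring).
  apply is_lim_seq_scal_l, is_lim_seq_geom.
  rewrite Rabs_pos_eq; lra.
Qed.

Lemma orbit_major_converges (p : R * R) : 0 < snd p <= fst p ->
  exists l : R, fst p - snd p <= l /\ is_lim_seq (fun n => fst (orbit p n)) l.
Proof.
intros H.
set (gap := fun n => fst (orbit p n) - snd (orbit p n)).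
assert (Hinc : forall n, gap n <= gap (S n)).
{ intros n; apply (gap_increases _ _ (orbit_cone p n H)). }
assert (Hbnd : forall n, gap n <= fst p + 5 * snd p).
{ intros n.
  assert (fst (orbit p n) + 5 * snd (orbit p n) <= fst p + 5 * snd p).
  { induction n as [|n IH]; [simpl; lra|].
    exact (Rle_trans _ _ _ (combined_decreases _ _ (orbit_cone p n H)) IH). }
  generalize (orbit_cone p n H); unfold gap; lra. }
destruct (ex_finite_lim_seq_incr gap _ Hinc Hbnd) as [l Hl].
exists l; split.
- exact (is_lim_seq_incr_compare gap l Hl Hinc 0%nat).
- apply is_lim_seq_ext with (fun n => gap n + snd (orbit p n)).
  { intros n; unfold gap; ring. }
  replace (Finite l) with (Finite (l + 0)) by (f_equal; ring).
  apply is_lim_seq_plus'; [exact Hl | now apply orbit_minor_vanishes].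
Qed.

Definition swap (p : R * R) : R * R := (snd p, fst p).

Lemma orbit_swap (p : R * R) (n : nat) : orbit (swap p) n = swap (orbit p n).
Proof.
unfold orbit; induction n; [reflexivity | simpl; now rewrite IHn].
Qed.

Lemma orbit_diagonal (a : R) (n : nat) :
  fst (orbit (a, a) n) = snd (orbit (a, a) n).
Proof. exact (f_equal fst (orbit_swap (a, a) n)). Qed.

(** * From real orbits to the two-box space *)

Lemma iter_Bhalf_real (p : R * R) (n : nat) : 0 < fst p -> 0 < snd p ->
  Nat.iter n Bhalf (real_elt p) = real_elt (orbit p n).
Proof.
intros H1 H2.
enough (H : 0 < fst (orbit p n) /\ 0 < snd (orbit p n) /\
  Nat.iter n Bhalf (real_elt p) = real_elt (orbit p n)) by apply H.
induction n as [|n (P1 & P2 & IH)]; [auto|].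
repeat split; try (apply half_coef_pos; assumption).
simpl; rewrite IH, (surjective_pairing (orbit p n)).
now apply Bhalf_real.
Qed.

Lemma converges_to_real (q : nat -> R * R) (l m : R) :
  is_lim_seq (fun n => fst (q n)) l -> is_lim_seq (fun n => snd (q n)) m ->
  converges_to (fun n => real_elt (q n)) (real_elt (l, m)).
Proof.
intros Hl Hm; apply is_lim_seq_spec in Hl, Hm.
apply filterlim_locally; intros eps.
generalize (filter_and _ _ (Hl eps) (Hm eps)); apply filter_imp.
intros n [B1 B2]; split; split; try assumption; apply ball_center.
Qed.

(** * The initial condition and the critical temperature *)

Definition boltz (beta : R) : R * R :=
  (exp beta - exp (- beta), sqrt 2 * exp (- beta)).

Lemma Boltz_real (beta : R) : Boltz beta = real_elt (boltz beta).
Proof. unfold Boltz, boltz, real_elt; p2_eq. Qed.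

Lemma inv_Tc : / Tc = ln (delta + 1) / 2.
Proof.
pose proof delta_bounds.
assert (0 < ln (delta + 1)) by (rewrite <- ln_1; apply ln_increasing; lra).
unfold Tc; fold delta; field; lra.
Qed.

Lemma exp_two_inv_Tc : exp (2 * / Tc) = delta + 1.
Proof.
pose proof delta_bounds; rewrite inv_Tc.
replace (2 * (_ / 2)) with (ln (delta + 1)) by field.
apply exp_ln; lra.
Qed.

(** The first coefficient is [exp (- beta) (exp (2 beta) - 1)], so comparing it
    with the second compares [exp (2 beta)] with [1 + sqrt 2]. *)
Lemma Boltz_gap (beta : R) :
  fst (boltz beta) - snd (boltz beta) =
  exp (- beta) * (exp (2 * beta) - exp (2 * / Tc)).
Proof.
unfold boltz; cbn [fst snd]; rewrite exp_two_inv_Tc; unfold delta.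
replace (2 * beta) with (beta + beta) by ring.
rewrite exp_plus, exp_Ropp; field; apply Rgt_not_eq, exp_pos.
Qed.

Theorem theorem1p2 :
  exists c1 c2 : R -> R,
    forall beta : R, 0 < beta ->
      (beta < / Tc ->
         0 < c1 beta /\
         converges_to (fun n => Nat.iter n Bhalf (Boltz beta)) (pscal (RtoC (c1 beta)) E)) /\
      (beta = / Tc ->
         converges_to (fun n => Nat.iter n Bhalf (Boltz beta)) pzero) /\
      (/ Tc < beta ->
         0 < c2 beta /\
         converges_to (fun n => Nat.iter n Bhalf (Boltz beta)) (pscal (RtoC (c2 beta)) Id2)).
Proof.
(* The convergence argument only shows that the limits exist; the total
   operator [Lim_seq] names them uniformly in [beta], without any choice. *)
exists (fun beta => real (Lim_seq (fun n => snd (orbit (boltz beta) n)))).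
exists (fun beta => real (Lim_seq (fun n => fst (orbit (boltz beta) n)))).
intros beta Hbeta.
assert (Ha : 0 < fst (boltz beta)).
{ cbn; assert (exp (- beta) < exp beta) by (apply exp_increasing; lra); lra. }
assert (Hb : 0 < snd (boltz beta)).
{ apply Rmult_lt_0_compat; [exact delta_pos | apply exp_pos]. }
pose proof (exp_pos (- beta)) as He.
pose proof (Boltz_gap beta) as G.
assert (Conv : forall l m : R,
  is_lim_seq (fun n => fst (orbit (boltz beta) n)) l ->
  is_lim_seq (fun n => snd (orbit (boltz beta) n)) m ->
  converges_to (fun n => Nat.iter n Bhalf (Boltz beta)) (real_elt (l, m))).
{ intros l m Hl Hm.
  apply filterlim_ext with (fun n => real_elt (orbit (boltz beta) n)).
  - intros n; rewrite Boltz_real; symmetry; now apply iter_Bhalf_real.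
  - now apply converges_to_real. }
split; [|split]; intros Hc.
- assert (exp (2 * beta) < exp (2 * / Tc)) by (apply exp_increasing; lra).
  assert (Hgap : fst (boltz beta) - snd (boltz beta) < 0) by (rewrite G; nra).
  assert (Hcone : 0 < snd (swap (boltz beta)) <= fst (swap (boltz beta)))
    by (cbn in *; lra).
  destruct (orbit_major_converges _ Hcone) as [l [Hl Hlim]].
  pose proof (orbit_minor_vanishes _ Hcone) as Hzero.
  apply is_lim_seq_ext with (v := fun n => snd (orbit (boltz beta) n)) in Hlim;
    [|intros n; now rewrite orbit_swap].
  apply is_lim_seq_ext with (v := fun n => fst (orbit (boltz beta) n)) in Hzero;
    [|intros n; now rewrite orbit_swap].
  rewrite (is_lim_seq_unique _ _ Hlim); cbn in Hl |- *; split; [cbn in Hgap; lra|].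
  replace (pscal (RtoC l) E) with (real_elt (0, l)) by (unfold real_elt; p2_eq).
  now apply Conv.
- assert (Hdiag : boltz beta = (fst (boltz beta), fst (boltz beta))).
  { assert (H : exp (2 * beta) = exp (2 * / Tc)) by (now rewrite Hc).
    rewrite H, Rminus_diag, Rmult_0_r in G.
    rewrite (surjective_pairing (boltz beta)) at 1; f_equal; lra. }
  assert (Hcone : 0 < snd (boltz beta) <= fst (boltz beta)).
  { rewrite Hdiag in Hb |- *; cbn in *; lra. }
  pose proof (orbit_minor_vanishes _ Hcone) as Hzero.
  apply (Conv 0 0); [|exact Hzero].
  apply is_lim_seq_ext with (2 := Hzero).
  intros n; rewrite Hdiag; symmetry; apply orbit_diagonal.
- assert (exp (2 * / Tc) < exp (2 * beta)) by (apply exp_increasing; lra).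
  assert (Hgap : 0 < fst (boltz beta) - snd (boltz beta)) by (rewrite G; nra).
  assert (Hcone : 0 < snd (boltz beta) <= fst (boltz beta)) by lra.
  destruct (orbit_major_converges _ Hcone) as [l [Hl Hlim]].
  pose proof (orbit_minor_vanishes _ Hcone) as Hzero.
  rewrite (is_lim_seq_unique _ _ Hlim); cbn [real]; split; [lra|].
  replace (pscal (RtoC l) Id2) with (real_elt (l, 0)) by (unfold real_elt; p2_eq).
  now apply Conv.
Qed.
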